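(* Fix $P\in\mathcal P$ and a policy $\pi:\mathcal X\to\Delta(\mathcal D)$. Let $\ell^{\mathrm{add}}$ be an additive counterfactual loss, $\ell^{\mathrm{add}}(d;\boldsymbol y,\boldsymbol x)=\varpi(\boldsymbol y,\boldsymbol x)+\sum_{k\in\mathcal D}\omega_k(d,y_k,\boldsymbol x)$ with bounded measurable $\omega_k:\mathcal D\times\mathcal Y\times\mathcal X\to\mathbb R$ and $\varpi:\mathcal Y^{\mathcal D}\times\mathcal X\to\mathbb R$. Then, for $P_{\boldsymbol X}$-almost every $\boldsymbol x$, $$R_{P_{Y(\mathcal D)\mid\boldsymbol X=\boldsymbol x}}(\pi;\ell^{\mathrm{add}})=\sum_{d\in\mathcal D}\sum_{k\in\mathcal D}\sum_{y\in\mathcal Y}\omega_k(d,y,\boldsymbol x)\,\pi(d;\boldsymbol x)\,P(Y=y\mid D=k,\boldsymbol X=\boldsymbol x)+C_{P_{Y(\mathcal D)\mid\boldsymbol X}}(\boldsymbol x),$$ where $$C_{P_{Y(\mathcal D)\mid\boldsymbol X}}(\boldsymbol x)=\sum_{\boldsymbol y\in\mathcal Y^{\mathcal D}}\varpi(\boldsymbol y,\boldsymbol x)\,P(Y(\mathcal D)=\boldsymbol y\mid\boldsymbol X=\boldsymbol x).$$ Thus, for any pair of policies $\pi,\rho$, the difference of conditional counterfactual risks $R_{P_{Y(\mathcal D)\mid\boldsymbol X}}(\pi;\ell^{\mathrm{add}})-R_{P_{Y(\mathcal D)\mid\boldsymbol X}}(\rho;\ell^{\mathrm{add}})$ is identifiable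 from the conditional observed law $Q_P(D,Y\mid\boldsymbol X)$.
   Context: Setup. Let $\mathcal X$ be an arbitrary measurable space, $K,M\ge 2$ integers, $\mathcal D=\{0,\dots,K-1\}$ (decisions), $\mathcal Y=\{0,\dots,M-1\}$ (outcomes). $\Delta(S)$ denotes the set of probability measures on $S$. Potential outcomes are $Y(k)\in\mathcal Y$, $k\in\mathcal D$, with $Y(\mathcal D)=(Y(0),\dots,Y(K-1))\in\mathcal Y^{\mathcal D}$; covariates are $\boldsymbol X\in\mathcal X$; $D\in\mathcal D$ is the observed decision. Given a law $P_{Y(\mathcal D),\boldsymbol X}\in\Delta(\mathcal Y^{\mathcal D}\times\mathcal X)$ and a treatment assignment mechanism (a measurable map $e:\mathcal Y^{\mathcal D}\times\mathcal X\to\Delta(\mathcal D)$, written $e(k;\boldsymbol y,\boldsymbol x)$), the joint law $P=e\cdot P_{Y(\mathcal D),\boldsymbol X}$ of $(D,Y(\mathcal D),\boldsymbol X)$ is $$P(D=k,Y(\mathcal D)=\boldsymbol y,\boldsymbol X\in A)=\int_A e(k;\boldsymbol y,\boldsymbol x)\,P_{Y(\mathcal D)\mid\boldsymbol X}(Y(\mathcal D)=\boldsymbol y\mid\boldsymbol X=\boldsymbol x)\,dP_{\boldsymbol X}(\boldsymbol x)$$ for $A\subseteq\mathcal X$ measurable. Consistency: the observed outcome is $Y=Y(D)$. Strong ignorability of $e$ with respect to $P_{Y(\mathcal D),\boldsymbol X}$: (a) unconfoundedness, $e(d;\boldsymbol y,\boldsymbol x)=e(d;\boldsymbol x)$ for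 every $d\in\mathcal D$, $P_{Y(\mathcal D),\boldsymbol X}$-a.s.; (b) overlap, $e(d;\boldsymbol x)>0$ for every $d\in\mathcal D$, $P_{\boldsymbol X}$-a.s. $\mathcal P$ is the set of all joint laws $P=e\cdot P_{Y(\mathcal D),\boldsymbol X}$ with $P_{Y(\mathcal D),\boldsymbol X}\in\Delta(\mathcal Y^{\mathcal D}\times\mathcal X)$ arbitrary and $e$ strongly ignorable with respect to it. The observed law $Q_P$ of $(D,Y,\boldsymbol X)$ is $Q_P(D=k,Y=y,\boldsymbol X\in A)=P(D=k,Y(k)=y,\boldsymbol X\in A)$. A policy is a (measurable) map $\pi:\mathcal X\to\Delta(\mathcal D)$, written $\pi(d;\boldsymbol x)$. A counterfactual loss is a measurable function $\ell:\mathcal D\times\mathcal Y^{\mathcal D}\times\mathcal X\to\mathbb R$, assumed bounded. The conditional counterfactual risk is $$R_{P_{Y(\mathcal D)\mid\boldsymbol X=\boldsymbol x}}(\pi;\ell)=\sum_{d\in\mathcal D}\sum_{\boldsymbol y\in\mathcal Y^{\mathcal D}}\ell(d;\boldsymbol y,\boldsymbol x)\,\pi(d;\boldsymbol x)\,P(Y(\mathcal D)=\boldsymbol y\mid\boldsymbol X=\boldsymbol x)$$ (defined $P_{\boldsymbol X}$-a.s.). Identifiability of a conditional quantity $\theta_P(\boldsymbol X)$ from $Q_P(D,Y\mid\boldsymbol X)$: for all $P_1,P_2\in\mathcal P$ with common covariate marginal $\mu$ and $Q_{P_1}(D,Y\mid\boldsymbol X)=Q_{P_2}(D,Y\mid\boldsymbol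 X)$ $\mu$-a.s., one has $\theta_{P_1}(\boldsymbol X)=\theta_{P_2}(\boldsymbol X)$ $\mu$-a.s. *)

(* Defs.v *)
From HB Require Import structures.
From mathcomp Require Import all_boot all_order all_algebra.
From mathcomp Require Import all_classical all_reals all_analysis.
Set Implicit Arguments.
Unset Strict Implicit.
Unset Printing Implicit Defensive.
Import Order.TTheory GRing.Theory Num.Theory.
Import numFieldNormedType.Exports.
Local Open Scope classical_set_scope.
Local Open Scope ring_scope.

(* {0, ..., n-1} for n >= 1, with its discrete sigma-algebra. A measurableType
   must be pointed, hence n.-1.+1, which is equal to n as soon as n >= 1. *)
Definition level (n : nat) := 'I_n.-1.+1.
HB.instance Definition _ n := Finite.on (level n).
HB.instance Definition _ n := isPointed.Build (level n) ord0.
HB.instance Definition _ n := @isMeasurable.Build default_measure_display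
  (level n) discrete_measurable discrete_measurable0
  discrete_measurableC discrete_measurableU.

(* Vectors of potential outcomes (Y(0), ..., Y(K-1)); the discrete sigma-algebra
   is the product of the discrete ones, all the sets being finite. *)
Definition potentials (K M : nat) := {ffun level K -> level M}.
HB.instance Definition _ K M := Finite.on (potentials K M).
HB.instance Definition _ K M :=
  isPointed.Build (potentials K M) [ffun=> point].
HB.instance Definition _ K M := @isMeasurable.Build default_measure_display
  (potentials K M) discrete_measurable discrete_measurable0
  discrete_measurableC discrete_measurableU.

Section conditional_probability.
Context d d' (T : measurableType d) (T' : measurableType d') (R : realType).
Implicit Types (P : probability T R) (E : set T) (Z : {mfun T >-> T'}).

(* p is a version of z |-> P(E | Z = z). *)
Definition is_cond_prob P E Z (p : T' -> R) : Prop :=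
  (distribution P Z).-integrable setT (EFin \o p) /\
  forall B, measurable B ->
    P (E `&` Z @^-1` B) = (\int[distribution P Z]_(z in B) (p z)%:E)%E.

(* A chosen version: by the two lemmas below it exists for measurable E and is
   unique up to a P_Z-null set, so that statements holding P_Z-almost surely do
   not depend on the choice. *)
Definition cond_prob P E Z : T' -> R :=
  xget (cst 0) [set p | is_cond_prob P E Z p].

Lemma cond_probP P E Z : measurable E -> is_cond_prob P E Z (cond_prob P E Z).
Proof.
move=> mE; rewrite /cond_prob; case: xgetP => [p _ //|noP]; exfalso.
have mZ : measurable_fun setT Z by [].
pose nu : set T' -> \bar R := pushforward (mrestr P mE) Z.
pose nuM : {measure set T' -> \bar R} := nu.
have nufin : fin_num_fun nu.
  move=> B mB; rewrite /nu /pushforward /mrestr fin_num_measure//.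
  apply: measurableI => //; rewrite -[X in measurable X]setTI.
  exact: (mZ measurableT).
pose nuF := Measure_isFinite.Build _ _ _ nu nufin.
pose nuFM : {finite_measure set T' -> \bar R} := HB.pack nu (nuF mZ) (nuM mZ).
have dom : charge_of_finite_measure nuFM `<< distribution P Z.
  apply/null_content_dominatesP => A mA A0.
  apply/eqP; rewrite eq_le; apply/andP; split; last exact: measure_ge0 nuFM _.
  rewrite -A0 /charge_of_finite_measure/= /nu /distribution /pushforward /mrestr.
  have mZA : measurable (Z @^-1` A).
    by rewrite -[X in measurable X]setTI; exact: (mZ measurableT).
  by apply: le_measure; rewrite ?inE//; exact: measurableI.
pose f := Radon_Nikodym (charge_of_finite_measure nuFM) (distribution P Z).
have fE : EFin \o (fine \o f) = f.
  by apply/funext => x /=; rewrite fineK//; exact: Radon_Nikodym_fin_num.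
apply: (noP (fine \o f)); split => [|B mB].
  by rewrite fE; exact: Radon_Nikodym_integrable.
have := Radon_Nikodym_integral dom mB.
rewrite /charge_of_finite_measure/= /nu /pushforward /mrestr setIC => ->.
by apply: eq_integral => z _; exact/esym/(congr1 (@^~ z) fE).
Qed.

Lemma is_cond_prob_unique P E Z (p q : T' -> R) :
  is_cond_prob P E Z p -> is_cond_prob P E Z q ->
  {ae distribution P Z, forall z, p z = q z}.
Proof.
move=> [ip hp] [iq hq].
have : ae_eq (distribution P Z) setT (EFin \o p) (EFin \o q).
  apply: integral_ae_eq => //.
    by have /integrableP[] := iq.
  by move=> B _ mB /=; rewrite -hp// -hq.
by apply: filterS => z /(_ I) [].
Qed.

End conditional_probability.


HB.instance Definition _ d d' (T : measurableType d) (T' : measurableType d') :=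
  isMeasurableFun.Build _ _ _ _ (@snd T T') measurable_snd.

Section sample_space.
Context d (X : measurableType d) (K M : nat).

Definition sample : Type := (level K * potentials K M * X)%type.
HB.instance Definition _ := Measurable.on sample.

Definition observation : Type := (level K * level M * X)%type.
HB.instance Definition _ := Measurable.on observation.

Definition decision (w : sample) : level K := w.1.1.
Definition outcomes (w : sample) : potentials K M := w.1.2.
Definition covariates (w : sample) : X := w.2.

(* Consistency, Y = Y(D). *)
Definition outcome (w : sample) : level M := outcomes w (decision w).

Definition decision_covariates (w : sample) : level K * X :=
  (decision w, covariates w).
Definition observe (w : sample) : observation :=
  (decision w, outcome w, covariates w).

Let measurable_decision : measurable_fun setT decision.
Proof. exact: measurableT_comp. Qed.

Let measurable_outcomes : measurable_fun setT outcomes.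
Proof. exact: measurableT_comp. Qed.

Let measurable_covariates : measurable_fun setT covariates.
Proof. exact: measurable_snd. Qed.

Let measurable_outcome : measurable_fun setT outcome.
Proof.
move=> _ B _; rewrite setTI.
rewrite (_ : _ @^-1` _ = \bigcup_(k in [set: level K])
  (decision @^-1` [set k] `&` outcomes @^-1` [set f | B (f k)])).
  apply: fin_bigcup_measurable => [|k _]; first exact: finite_finset.
  apply: measurableI; rewrite -[X in measurable X]setTI.
    exact: measurable_decision.
  exact: measurable_outcomes.
apply/seteqP; split => w /=; first by move=> Bw; exists (decision w).
by case=> k _ [/= <- Bw].
Qed.

Let measurable_decision_covariates : measurable_fun setT decision_covariates.
Proof. exact: measurable_fun_pair. Qed.

Let measurable_observe : measurable_fun setT observe.
Proof.
by apply: measurable_fun_pair => //; exact: measurable_fun_pair.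
Qed.

HB.instance Definition _ :=
  isMeasurableFun.Build _ _ _ _ covariates measurable_covariates.
HB.instance Definition _ :=
  isMeasurableFun.Build _ _ _ _ decision_covariates
    measurable_decision_covariates.
HB.instance Definition _ :=
  isMeasurableFun.Build _ _ _ _ observe measurable_observe.

End sample_space.
Arguments decision {d X K M}.
Arguments outcomes {d X K M}.
Arguments covariates {d X K M}.
Arguments outcome {d X K M}.
Arguments decision_covariates {d X K M}.
Arguments observe {d X K M}.

Section model.
Context d (X : measurableType d) (K M : nat) (R : realType).
Implicit Types (P : probability (sample X K M) R)
  (PYX : probability (potentials K M * X)%type R)
  (e : R.-pker (potentials K M * X) ~> level K).

(* e0(k; x) is the common value e(k; x) of the e(k; y, x). *)
Definition strongly_ignorable e PYX : Prop :=
  exists e0 : R.-pker X ~> level K,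
    (forall k, {ae PYX, forall yx, e yx [set k] = e0 yx.2 [set k]}) /\
    (forall k, {ae distribution PYX snd, forall x, (0 < e0 x [set k])%E}).

(* P = e . P_{Y(.), X}: the sets below form a generating pi-system, so that P is
   determined by e and PYX. *)
Definition is_joint_law e PYX P : Prop :=
  forall (k : level K) (y : potentials K M) (A : set X), measurable A ->
    P [set w | [/\ decision w = k, outcomes w = y & A (covariates w)]] =
    (\int[distribution PYX snd]_(x in A)
      (e (y, x) [set k] * (cond_prob PYX [set yx | yx.1 = y] snd x)%:E))%E.

Definition ignorable_laws : set (probability (sample X K M) R) :=
  [set P | exists PYX e, strongly_ignorable e PYX /\ is_joint_law e PYX P].

Definition observed_law P : probability (observation X K M) R :=
  distribution P observe.

Definition observed_cond_law P (k : level K) (y : level M) : X -> R :=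
  cond_prob (observed_law P) [set w | w.1 = (k, y)] snd.

Definition outcomes_cond_law P (y : potentials K M) : X -> R :=
  cond_prob P [set w | outcomes w = y] covariates.

(* P(Y = y | D = k, X = x), conditioning on the pair (D, X). *)
Definition outcome_regression P (y : level M) (k : level K) (x : X) : R :=
  cond_prob P [set w | outcome w = y] decision_covariates (k, x).

Definition identifiable (theta : probability (sample X K M) R -> X -> R) :=
  forall P1 P2, ignorable_laws P1 -> ignorable_laws P2 ->
    (forall A, measurable A ->
      distribution P1 covariates A = distribution P2 covariates A) ->
    {ae distribution P1 covariates, forall x, forall k y,
      observed_cond_law P1 k y x = observed_cond_law P2 k y x} ->
    {ae distribution P1 covariates, forall x, theta P1 x = theta P2 x}.

Definition policy_prob (pi : R.-pker X ~> level K) (k : level K) (x : X) : R :=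
  fine (pi x [set k]).

Definition cond_risk P (pi : R.-pker X ~> level K)
    (l : level K -> potentials K M -> X -> R) (x : X) : R :=
  \sum_(k : level K) \sum_(y : potentials K M)
    l k y x * policy_prob pi k x * outcomes_cond_law P y x.

Definition additive_loss (varpi : potentials K M -> X -> R)
    (omega : level K -> level K -> level M -> X -> R)
    (k : level K) (y : potentials K M) (x : X) : R :=
  varpi y x + \sum_(j : level K) omega j k (y j) x.

Definition intercept P (varpi : potentials K M -> X -> R) (x : X) : R :=
  \sum_(y : potentials K M) varpi y x * outcomes_cond_law P y x.

End model.

Definition bounded_measurable d (T : measurableType d) (R : realType)
    (f : T -> R) : Prop :=
  measurable_fun setT f /\ [bounded f z | z in setT].

(* Main.v *)
Require Import Defs.
From HB Require Import structures.
From mathcomp Require Import all_boot all_order all_algebra.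
From mathcomp Require Import all_classical all_reals all_analysis.
From mathcomp Require Import measurable_realfun.
Set Implicit Arguments.
Unset Strict Implicit.
Unset Printing Implicit Defensive.
Import Order.TTheory GRing.Theory Num.Theory.
Import numFieldNormedType.Exports.
Local Open Scope classical_set_scope.
Local Open Scope ring_scope.

(** Write p_y(x) for P(Y(.) = y | X = x), o_k,y(x) for P(D = k, Y = y | X = x),
    c_k(x) for P(D = k | X = x), so that c_k is the sum over y of o_k,y, and
    r_k,y(x) for P(Y = y | D = k, X = x).

    An additive loss sees a vector of potential outcomes one coordinate at a
    time. Summing it against p and grouping the vectors by their k-th
    coordinate, the risk depends on p only through the marginals
    s_k,y = P(Y(k) = y | X), apart from the term in varpi, in which the decision
    probabilities of the policy sum to 1 (additive_cond_risk). It remains to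
    see that s_k,y = r_k,y, and that this is a function of the observed law.

    Strong ignorability says that P(D = k, Y(.) = y | X) = e_k p_y where
    e_k(x) > 0 does not depend on y (ignorable_factor). Summing over the vectors
    with k-th coordinate y gives o_k,y = e_k s_k,y, by consistency, and summing
    over y gives c_k = e_k, because the p_y add up to 1. Hence
    o_k,y = s_k,y c_k with c_k > 0 (ignorable_observed_cond_law).

    On the other hand, for every law, o_k,y = r_k,y c_k: this is the chain rule
    P(E, D = k | X) = P(E | D = k, X) P(D = k | X) (is_cond_prob_chain,
    outcome_regressionP). Since c_k > 0, cancellation gives s_k,y = r_k,y, the
    first claim, and r_k,y = o_k,y / c_k, a function of the observed law
    (ignorable_regression). The varpi term being the same for all policies, it
    cancels in a difference of risks, and identifiability follows.

    All the conditional probabilities are versions defined up to null sets, so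
    each identity above is obtained by showing that both sides have the same
    integrals and applying the almost sure uniqueness of versions. *)

(** * Partitions of an event by a finite-valued function *)

Section finite_partitions.
Context d (T : measurableType d) (R : realType).
Local Open Scope ereal_scope.

Lemma measure_fibres (mu : {measure set T -> \bar R}) (I : finType)
    (F : T -> I) (Q : pred I) (E : set T) :
  (forall i, measurable (E `&` [set w | F w = i])) ->
  mu (E `&` [set w | Q (F w)]) =
  \sum_(i | Q i) mu (E `&` [set w | F w = i]).
Proof.
move=> mE.
have -> : E `&` [set w | Q (F w)] =
    \bigcup_(i in [set i | Q i]) (E `&` [set w | F w = i]).
  apply/seteqP; split=> w /=; first by move=> [Ew Qw]; exists (F w).
  by move=> [i Qi [Ew Fw]]; split; rewrite // Fw.
rewrite measure_fin_bigcup//.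
- rewrite (fsbigE [seq i <- enum I | Q i]).
  + rewrite big_filter_cond big_enum_cond; apply: eq_bigl => i.
    by rewrite andTb; apply/andP/idP => [[]//|Qi]; split; rewrite // inE.
  + exact/filter_uniq/enum_uniq.
  + by move=> i /=; rewrite mem_filter => /andP[].
  + by move=> i /= Qi; rewrite mem_filter Qi mem_enum.
- exact: finite_finset.
- by apply/trivIsetP => i j _ _ ij; apply/seteqP; split => w //= [[_ ->] [_ /eqP]];
    rewrite (negbTE ij).
Qed.

Corollary measure_fibresT (mu : {measure set T -> \bar R}) (I : finType)
    (F : T -> I) (E : set T) :
  (forall i, measurable (E `&` [set w | F w = i])) ->
  mu E = \sum_i mu (E `&` [set w | F w = i]).
Proof.
move=> mE; rewrite -measure_fibres//; congr (mu _).
by apply/seteqP; split=> w /= => [|[]].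
Qed.

End finite_partitions.

(** * Slices of a measure on a product, and densities *)

Section slices.
Context d d' (U : measurableType d) (T : measurableType d') (R : realType).
Variables (la : {measure set (U * T) -> \bar R}) (k : U).
Hypothesis mk : measurable [set k].
Local Open Scope ereal_scope.

Lemma measurable_slice (B : set T) : measurable B ->
  measurable ([set k] `*` B).
Proof. exact: measurableX. Qed.

(** B |-> la ({k} x B), written as an image measure so that integration against
    it reduces to integration against a restriction of la. *)
Definition slice : set T -> \bar R :=
  pushforward (mrestr la (measurable_slice measurableT)) snd.

Let slice0 : slice set0 = 0.
Proof. by rewrite /slice /pushforward preimage_set0 measure0. Qed.

Let slice_ge0 B : 0 <= slice B.
Proof. exact: measure_ge0. Qed.

Let slice_sigma_additive : semi_sigma_additive slice.
Proof. exact: (@measure_semi_sigma_additive _ _ _ (pushforward _ _)). Qed.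

HB.instance Definition _ := isMeasure.Build _ _ _ slice
  slice0 slice_ge0 slice_sigma_additive.

Lemma sliceE (B : set T) : slice B = la ([set k] `*` B).
Proof.
rewrite /slice /pushforward /mrestr; congr (la _).
by apply/seteqP; split=> -[u t] /=; [move=> [? [->]]|move=> [-> ]].
Qed.

(** The restriction of la to {k} x T does not charge the complement of that set,
    on which f (k, z.2) and f z may differ. *)
Lemma ge0_integral_slice (f : U * T -> \bar R) (B : set T) :
  measurable_fun [set: U * T] f -> (forall z, 0 <= f z) -> measurable B ->
  \int[slice]_(x in B) f (k, x) = \int[la]_(z in [set k] `*` B) f z.
Proof.
move=> mf f0 mB; set C := [set k] `*` [set: T].
have mC : measurable C by exact: measurable_slice.
have mfk : measurable_fun setT (fun x => f (k, x)).
  exact: measurableT_comp mf (pair1_measurable k).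
have m2B : measurable (@snd U T @^-1` B).
  by rewrite -[X in measurable X]setTI; exact: measurable_snd.
rewrite ge0_integral_pushforward//; last exact: measurable_funTS.
rewrite (@ge0_negligible_integral _ _ _ _ _ (~` C))//=.
- rewrite (_ : _ `\` _ = [set k] `*` B); last first.
    apply/seteqP; split=> -[u t] /=.
      by rewrite /C /setD/= => -[Bt /contrapT[-> _]].
    by rewrite /C /setD/= => -[-> Bt]; split => //; case; split.
  rewrite (eq_measure_integral la); last first.
    by move=> A mA AB; rewrite /= /mrestr setIidl// => z /AB [].
  by apply: eq_integral => -[u t]; rewrite inE /= => -[-> _].
- exact: measurableC.
- by apply: measurable_funTS; exact: (measurableT_comp mfk measurable_snd).
- by rewrite /mrestr setICl measure0.
Qed.

Lemma integral_slice (f : U * T -> \bar R) (B : set T) :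
  measurable_fun [set: U * T] f -> measurable B ->
  \int[slice]_(x in B) f (k, x) = \int[la]_(z in [set k] `*` B) f z.
Proof.
move=> mf mB; rewrite integralE [RHS]integralE; congr (_ - _).
- rewrite -(@ge0_integral_slice f^\+)//; last exact: measurable_funepos.
  by apply: eq_integral => x _; rewrite !funeposE.
- rewrite -(@ge0_integral_slice f^\-)//; last exact: measurable_funeneg.
  by apply: eq_integral => x _; rewrite !funenegE.
Qed.

Lemma integrable_slice (f : U * T -> \bar R) :
  la.-integrable setT f -> slice.-integrable setT (fun x => f (k, x)).
Proof.
move=> /[dup] fi /integrableP[mf foo]; apply/integrableP; split.
  exact: measurableT_comp mf (pair1_measurable k).
have mabs : measurable_fun setT (abse \o f) by exact: measurableT_comp.
rewrite (ge0_integral_slice mabs)//; last by move=> z; exact: abse_ge0.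
apply: le_lt_trans foo.
apply: ge0_subset_integral => //; first exact: measurable_slice.
by move=> z _; exact: abse_ge0.
Qed.

End slices.

Section densities.
Context d (T : measurableType d) (R : realType).
Variables (nu mu : {finite_measure set T -> \bar R}) (g : T -> \bar R).
Hypotheses (gi : mu.-integrable setT g)
  (nuE : forall A, measurable A -> nu A = (\int[mu]_(x in A) g x)%E).
Local Open Scope ereal_scope.

(** The Radon-Nikodym derivative of nu is a density of nu, hence is almost
    everywhere equal to g, and the change of variables formula for it carries
    over to g. *)
Lemma integral_density (f : T -> \bar R) (B : set T) : measurable B ->
  nu.-integrable B f -> \int[mu]_(x in B) (f x * g x) = \int[nu]_(x in B) f x.
Proof.
move=> mB fi.
have dom : nu `<< mu.
  apply/null_content_dominatesP => A mA A0.
  rewrite nuE// null_set_integral//.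
  exact/measurable_funTS/(measurable_int _ gi).
have mRN : measurable_fun setT
    (Radon_Nikodym (charge_of_finite_measure nu) mu).
  by apply: (measurable_int mu); exact: Radon_Nikodym_integrable.
rewrite -(Radon_Nikodym_change_of_variables dom mB fi).
have mf := measurable_int _ fi; have mg := measurable_int _ gi.
apply: ae_eq_integral => //.
- by apply: emeasurable_funM => //; exact: measurable_funTS.
- by apply: emeasurable_funM => //; exact: measurable_funTS.
- apply: ae_eqe_mul2l; apply: integral_ae_eq => //.
  + exact: (integrableS measurableT).
  + exact: measurable_funTS.
  + by move=> A _ mA; rewrite -Radon_Nikodym_integral// -nuE.
Qed.

End densities.

(** * Calculus of conditional probabilities *)

(** Negligibility is witnessed by measurable sets, so agreement on those is
    enough, even when mu and nu differ as functions on all sets. *)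
Lemma ae_eq_measure d (T : measurableType d) (R : realType)
    (mu nu : set T -> \bar R) (Q : T -> Prop) :
  (forall A, measurable A -> mu A = nu A) ->
  {ae mu, forall x, Q x} -> {ae nu, forall x, Q x}.
Proof. by move=> mnE [N [mN N0 QN]]; exists N; split; rewrite -?mnE. Qed.

Section versions.
Context d d' (T : measurableType d) (T' : measurableType d') (R : realType).
Implicit Types (P : probability T R) (E : set T) (Z : {mfun T >-> T'}).
Local Open Scope ereal_scope.

Lemma is_cond_prob_setT P Z : is_cond_prob P setT Z (cst 1%R).
Proof.
split; first exact: finite_measure_integrable_cst.
move=> B mB; rewrite setTI -[LHS]mul1e; apply/esym.
exact: (integral_cst (distribution P Z) mB 1).
Qed.

Lemma is_cond_prob_fibres P Z (I : finType) (F : T -> I) (Q : pred I) E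
    (p : I -> T' -> R) :
  (forall i, measurable (E `&` [set w | F w = i])) ->
  (forall i, is_cond_prob P (E `&` [set w | F w = i]) Z (p i)) ->
  is_cond_prob P (E `&` [set w | Q (F w)]) Z (fun z => \sum_(i | Q i) p i z)%R.
Proof.
move=> mE hp.
have sumE : EFin \o (fun z => \sum_(i | Q i) p i z)%R =
    (fun z => \sum_(i | Q i) (p i z)%:E).
  by apply/funext => z /=; rewrite sumEFin.
split=> [|B mB].
  by rewrite sumE; apply: integrable_sum => // i _; have [] := hp i.
have mZB : measurable (Z @^-1` B) by exact: measurable_funPTI.
rewrite setIAC measure_fibres; last first.
  by move=> i; rewrite setIAC; exact: measurableI.
under [RHS]eq_integral do rewrite -sumEFin.
rewrite integral_sum//.
  by apply: eq_bigr => i _; rewrite setIAC; exact: (hp i).2.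
by move=> i; apply: (integrableS measurableT) => //; exact: (hp i).1.
Qed.

Corollary is_cond_prob_fibresT P Z (I : finType) (F : T -> I) E
    (p : I -> T' -> R) :
  (forall i, measurable (E `&` [set w | F w = i])) ->
  (forall i, is_cond_prob P (E `&` [set w | F w = i]) Z (p i)) ->
  is_cond_prob P E Z (fun z => \sum_i p i z)%R.
Proof.
move=> mE hp; rewrite (_ : E = E `&` [set w | predT (F w)]).
  exact: is_cond_prob_fibres.
by apply/seteqP; split=> w /= => [|[]].
Qed.

(** Chain rule, P(E, V = k | Z) = P(E | V = k, Z) P(V = k | Z) with W = (V, Z).
    The measure nu = P(V = k, Z in .) has density p with respect to the law of
    Z, so that integrating r(k, .) p over B amounts to integrating r(k, .)
    against nu, that is, r over {k} x B against the law of W; the result is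
    P(E, V = k, Z in B). *)
Lemma is_cond_prob_chain d0 (U : measurableType d0) P E (W : {mfun T >-> (U * T')%type})
    Z (k : U) (mk : measurable [set k]) (p q : T' -> R) (r : U * T' -> R) :
  (forall w, Z w = (W w).2) ->
  is_cond_prob P E W r ->
  is_cond_prob P [set w | (W w).1 = k] Z p ->
  is_cond_prob P (E `&` [set w | (W w).1 = k]) Z q ->
  {ae distribution P Z, forall z, q z = (r (k, z) * p z)%R}.
Proof.
move=> ZW [ri hr] [ip hp] [iq hq].
pose nu : {measure set T' -> \bar R} := slice (distribution P W) mk.
have preimW B : W @^-1` ([set k] `*` B) = [set w | (W w).1 = k] `&` Z @^-1` B.
  by apply/seteqP; split=> w /=; rewrite ZW.
have sE B : nu B = distribution P W ([set k] `*` B) by exact: sliceE.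
have nufin : fin_num_fun nu.
  by move=> B mB; rewrite sE fin_num_measure//; exact: measurable_slice.
pose nuF : {finite_measure set T' -> \bar R} :=
  HB.pack (nu : set T' -> \bar R) (Measure_isFinite.Build _ _ _ nu nufin) nu.
have nuE A : measurable A ->
    nuF A = \int[distribution P Z]_(x in A) (EFin \o p) x.
  move=> mA; rewrite -hp// -preimW; exact: sE.
suff : ae_eq (distribution P Z) setT (EFin \o q)
    (fun z => (EFin \o r) (k, z) * (EFin \o p) z).
  by apply: filterS => z /(_ I)/= [].
have ri' := integrable_slice mk ri.
apply: integral_ae_eq => //.
  apply: emeasurable_funM; first exact: measurable_int ri'.
  exact: measurable_int ip.
move=> B _ mB.
rewrite (integral_density (nu := nuF) ip nuE mB); last exact: (integrableS measurableT).
rewrite (integral_slice _ mk (measurable_int _ ri) mB) -hr; last first.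
  exact: measurable_slice.
by rewrite preimW setIA; apply/esym/hq.
Qed.

End versions.

(** * Probability kernels *)

Section kernels.
Context d d' (X : measurableType d) (Y : measurableType d') (R : realType).
Implicit Types (e : R.-pker X ~> Y).

Lemma pker_le1 e x (B : set Y) : measurable B -> (e x B <= 1)%E.
Proof.
move=> mB; rewrite -(prob_kernel (s := e) x).
by apply: le_measure; rewrite ?inE.
Qed.

Lemma pker_fineK e x (B : set Y) : measurable B -> ((fine (e x B))%:E = e x B)%E.
Proof.
move=> mB; rewrite fineK// ge0_fin_numE//.
by apply: le_lt_trans (pker_le1 e x mB) _; exact: ltry.
Qed.

Lemma measurable_fine_pker e (B : set Y) : measurable B ->
  measurable_fun setT (fun x => fine (e x B)).
Proof.
move=> mB; apply: measurableT_comp => //; exact: measurable_kernel.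
Qed.

Lemma bounded_fine_pker e (B : set Y) : measurable B ->
  [bounded fine (e x B) | x in [set: X]].
Proof.
move=> mB; exists 1; split; first exact: num_real.
move=> r r1 x _ /=; rewrite ger0_norm ?fine_ge0//.
by apply: le_trans (ltW r1); rewrite -lee_fin pker_fineK//; exact: pker_le1.
Qed.

End kernels.

Lemma sum_fine_pker d (X : measurableType d) (R : realType) (n : nat)
    (e : R.-pker X ~> level n) x :
  \sum_k fine (e x [set k]) = 1.
Proof.
apply: EFin_inj; rewrite -sumEFin -(prob_kernel (s := e) x).
rewrite (@measure_fibresT _ _ _ _ (level n) id)//.
by apply: eq_bigr => k _; rewrite (pker_fineK e) ?setTI.
Qed.

(** * The joint law of decision, potential outcomes and covariates *)

Section events.
Context d (X : measurableType d) (K M : nat).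

Lemma measurable_decision_eq (k : level K) :
  measurable [set w : sample X K M | decision w = k].
Proof.
have mD : measurable_fun [set: sample X K M] decision.
  exact: measurableT_comp.
by rewrite -[X in measurable X]setTI; exact: (mD measurableT [set k]).
Qed.

Lemma measurable_outcomes_eq (y : potentials K M) :
  measurable [set w : sample X K M | outcomes w = y].
Proof.
have mY : measurable_fun [set: sample X K M] outcomes.
  exact: measurableT_comp.
by rewrite -[X in measurable X]setTI; exact: (mY measurableT [set y]).
Qed.

Lemma measurable_outcome_eq (y : level M) :
  measurable [set w : sample X K M | outcome w = y].
Proof.
have mO : measurable_fun [set: sample X K M] (fun w => (observe w).1.2).
  by do 2?apply: measurableT_comp => //.
by rewrite -[X in measurable X]setTI; exact: (mO measurableT [set y]).
Qed.

End events.

Section joint_law.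
Context d (X : measurableType d) (K M : nat) (R : realType).
Variables (P : probability (sample X K M) R)
  (PYX : probability (potentials K M * X)%type R)
  (e : R.-pker (potentials K M * X) ~> level K).
Hypothesis PE : is_joint_law e PYX P.
Local Open Scope ereal_scope.

Let p0 (y : potentials K M) : X -> R :=
  cond_prob PYX [set yx | yx.1 = y] snd.
Let e0 (y : potentials K M) (k : level K) (x : X) : R := fine (e (y, x) [set k]).

Let measurable_fst_eq (y : potentials K M) :
  measurable [set yx : potentials K M * X | yx.1 = y].
Proof.
rewrite -[X in measurable X]setTI.
exact: (measurable_fst measurableT [set y]).
Qed.

Let p0P y := cond_probP PYX snd (measurable_fst_eq y).

Let measurable_e0 y k : measurable_fun setT (e0 y k).
Proof.
exact: (measurableT_comp (measurable_fine_pker e (B := [set k]) _)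
  (pair1_measurable y)).
Qed.

Let integrable_e0p0 y k :
  (distribution PYX snd).-integrable setT (fun x => (e0 y k x * p0 y x)%:E).
Proof.
under eq_fun do rewrite EFinM.
apply: (@integrableMr _ _ _ _ _ measurableT (e0 y k)) => //.
  have [r [rr hr]] := bounded_fine_pker e (B := [set k]) I.
  by exists r; split => // s rs x _; exact: hr.
exact: (p0P y).1.
Qed.

Let measurable_covariates_preim (A : set X) : measurable A ->
  measurable ((covariates : sample X K M -> X) @^-1` A).
Proof. by move=> mA; exact: (@measurable_funPTI _ _ _ _ covariates). Qed.

Let joint_lawE k y A : measurable A ->
  P ([set w | outcomes w = y] `&` [set w | decision w = k]
      `&` covariates @^-1` A) =
  \int[distribution PYX snd]_(x in A) (e0 y k x * p0 y x)%:E.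
Proof.
move=> mA; rewrite (_ : _ `&` _ =
    [set w | [/\ decision w = k, outcomes w = y & A (covariates w)]]).
  rewrite PE//; apply: eq_integral => x _.
  by rewrite EFinM pker_fineK.
by apply/seteqP; split=> w /=; [move=> [[]]|move=> []].
Qed.

(** The assignment mechanism leaves the law of the potential outcomes and
    covariates unchanged: its probabilities sum to 1 over the decisions. *)
Lemma joint_law_outcomes y A : measurable A ->
  P ([set w | outcomes w = y] `&` covariates @^-1` A) =
  PYX ([set yx | yx.1 = y] `&` snd @^-1` A).
Proof.
move=> mA; rewrite (@measure_fibresT _ _ _ _ (level K) decision); last first.
  move=> k; apply: measurableI; last exact: measurable_decision_eq.
  apply: measurableI; first exact: measurable_outcomes_eq.
  exact: measurable_covariates_preim.
rewrite (p0P y).2//.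
transitivity (\sum_k \int[distribution PYX snd]_(x in A)
    (e0 y k x * p0 y x)%:E).
  by apply: eq_bigr => k _; rewrite -joint_lawE// setIAC.
rewrite -integral_sum//; last first.
  by move=> k; apply: (integrableS measurableT).
apply: eq_integral => x _.
by rewrite sumEFin -big_distrl/= sum_fine_pker mul1r.
Qed.

Lemma joint_law_covariates A : measurable A ->
  distribution P covariates A = distribution PYX snd A.
Proof.
move=> mA; rewrite /distribution /pushforward.
have mC := measurable_covariates_preim mA.
have mS : measurable ((snd : potentials K M * X -> X) @^-1` A).
  by rewrite -[X in measurable X]setTI; exact: measurable_snd.
rewrite (@measure_fibresT _ _ _ _ (potentials K M) outcomes); last first.
  by move=> y; apply: measurableI => //; exact: measurable_outcomes_eq.
rewrite [RHS](@measure_fibresT _ _ _ _ (potentials K M) fst); last first.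
  by move=> y; exact: measurableI.
apply: eq_bigr => y _; rewrite setIC [in RHS]setIC.
exact: joint_law_outcomes.
Qed.

(** Conditional probabilities under P given the covariates may be computed with
    the covariate law of PYX. *)
Let is_cond_prob_joint E p :
  (forall A, measurable A -> P (E `&` covariates @^-1` A) =
    \int[distribution PYX snd]_(x in A) (p x)%:E) ->
  (distribution PYX snd).-integrable setT (EFin \o p) ->
  is_cond_prob P E covariates p.
Proof.
move=> hp /integrableP[mp ip]; split.
  apply/integrableP; split=> //; apply: le_lt_trans ip.
  rewrite (eq_measure_integral (distribution PYX snd))//.
  by move=> A mA _; exact: joint_law_covariates.
move=> A mA; rewrite hp//; apply: eq_measure_integral => B mB _.
exact/esym/joint_law_covariates.
Qed.

Lemma joint_law_cond_outcomes y :
  {ae distribution P covariates, forall x, outcomes_cond_law P y x = p0 y x}.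
Proof.
apply: (is_cond_prob_unique (cond_probP _ _ (measurable_outcomes_eq y))).
apply: is_cond_prob_joint; last exact: (p0P y).1.
by move=> A mA; rewrite joint_law_outcomes//; exact: (p0P y).2.
Qed.

Lemma joint_law_cond_decision y k :
  {ae distribution P covariates, forall x,
    cond_prob P ([set w | outcomes w = y] `&` [set w | decision w = k])
      covariates x = (e0 y k x * p0 y x)%R}.
Proof.
apply: is_cond_prob_unique.
  by apply: cond_probP; apply: measurableI;
    [exact: measurable_outcomes_eq|exact: measurable_decision_eq].
apply: is_cond_prob_joint; last exact: integrable_e0p0.
by move=> A mA; exact: joint_lawE.
Qed.

(** Unconfoundedness holds PYX-almost surely, whereas y is fixed here. On the set
    N of the x for which it fails at (y, x), the integrals of p0 y are
    PYX-probabilities of subsets of {y} x N, which is null; thus p0 y vanishes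
    almost surely on N and both sides are 0 there. *)
Lemma unconfounded_factor (eX : R.-pker X ~> level K) y k :
  {ae PYX, forall yx, e yx [set k] = eX yx.2 [set k]} ->
  {ae distribution PYX snd, forall x,
    (e0 y k x * p0 y x = fine (eX x [set k]) * p0 y x)%R}.
Proof.
move=> unc.
pose N := [set x | e (y, x) [set k] != eX x [set k]].
have mey : measurable_fun setT (fun x => e (y, x) [set k]).
  exact: (measurableT_comp (measurable_kernel e [set k] _) (pair1_measurable y)).
have mN : measurable N.
  rewrite -[N]setTI; apply: measurable_neqe => //.
  exact: measurable_kernel.
have : ae_eq (distribution PYX snd) N (EFin \o p0 y) (cst 0).
  apply: integral_ae_eq => //.
    by apply: (integrableS measurableT) => //; exact: (p0P y).1.
  move=> A AN mA; rewrite integral0 -(p0P y).2//.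
  have mS : measurable ((snd : potentials K M * X -> X) @^-1` A).
    by rewrite -[X in measurable X]setTI; exact: measurable_snd.
  apply/(measure_negligible (measurableI _ _ (measurable_fst_eq y) mS)).
  apply: negligibleS unc => -[y' x] /= [-> /AN Nx]; exact/eqP.
apply: filterS => x px /=.
have [exE|/px[->]] := eqVneq (e (y, x) [set k]) (eX x [set k]).
  by rewrite /e0 exE.
by rewrite !mulr0.
Qed.

End joint_law.

(** * Identification under strong ignorability *)

Section identification.
Context d (X : measurableType d) (K M : nat) (R : realType).
Implicit Types P : probability (sample X K M) R.

Lemma observed_cond_lawP P (k : level K) (y : level M) :
  is_cond_prob P ([set w | decision w = k] `&` [set w | outcome w = y])
    covariates (observed_cond_law P k y).
Proof.
have mE : measurable [set w : observation X K M | w.1 = (k, y)].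
  rewrite -[X in measurable X]setTI.
  have mf : measurable_fun [set: observation X K M] fst by exact: measurable_fst.
  apply: (mf measurableT [set (k, y)]).
  rewrite (_ : [set (k, y)] = [set k] `*` [set y]); first exact: measurableX.
  by apply/seteqP; split=> -[u v] /= [-> ->].
have [oi ho] := cond_probP (observed_law P) snd mE.
split; first exact: oi.
move=> B mB; rewrite -(ho B mB) /observed_law /distribution /pushforward.
congr (P _); apply/seteqP; split=> w; rewrite /preimage/=.
  by move=> [[-> ->]].
by move=> [[-> ->]].
Qed.

Lemma sum_observed_cond_law P (k : level K) :
  {ae distribution P covariates, forall x,
    cond_prob P [set w | decision w = k] covariates x =
    \sum_y observed_cond_law P k y x}.
Proof.
apply: is_cond_prob_unique.
  by apply: cond_probP; exact: measurable_decision_eq.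
apply: (@is_cond_prob_fibresT _ _ _ _ _ _ _ _ outcome) => y.
- by apply: measurableI;
    [exact: measurable_decision_eq|exact: measurable_outcome_eq].
- exact: observed_cond_lawP.
Qed.

(** The chain rule for the pair (D, X): the sum is the propensity P(D = k | X).
    It is kept as a factor because the regression is arbitrary where it
    vanishes. *)
Lemma outcome_regressionP P :
  {ae distribution P covariates, forall x, forall k y,
    observed_cond_law P k y x =
    outcome_regression P y k x * \sum_y' observed_cond_law P k y' x}.
Proof.
apply: filter_forall => k; apply: filter_forall => y.
have reg : is_cond_prob P [set w | outcome w = y] decision_covariates
    (cond_prob P [set w | outcome w = y] decision_covariates).
  by apply: cond_probP; exact: measurable_outcome_eq.
have := is_cond_prob_chain (k := k) (Z := covariates) _ _ reg.
move=> /(_ _ (cond_prob P [set w | decision w = k] covariates)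
           (observed_cond_law P k y)) chain.
have : {ae distribution P covariates, forall x, observed_cond_law P k y x =
    outcome_regression P y k x * cond_prob P [set w | decision w = k] covariates x}.
  apply: chain => //.
    by apply: cond_probP; exact: measurable_decision_eq.
  by rewrite setIC; exact: observed_cond_lawP.
by apply: filterS2 (sum_observed_cond_law P k) => x -> ->.
Qed.

Lemma sum_outcomes_cond_law P :
  {ae distribution P covariates, forall x, \sum_y outcomes_cond_law P y x = 1}.
Proof.
apply: is_cond_prob_unique (is_cond_prob_setT P covariates).
apply: (@is_cond_prob_fibresT _ _ _ _ _ _ _ _ outcomes) => y.
- by rewrite setTI; exact: measurable_outcomes_eq.
- by rewrite setTI; apply: cond_probP; exact: measurable_outcomes_eq.
Qed.

(** Consistency: when D = k, the event Y = y is Y(k) = y, the disjoint union of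
    the events Y(.) = yv over the vectors yv with yv k = y. *)
Lemma observed_cond_law_outcomes P (k : level K) (y : level M) :
  {ae distribution P covariates, forall x,
    observed_cond_law P k y x =
    \sum_(yv : potentials K M | yv k == y)
      cond_prob P ([set w | outcomes w = yv] `&` [set w | decision w = k])
        covariates x}.
Proof.
apply: (is_cond_prob_unique (observed_cond_lawP P k y)).
rewrite (_ : _ `&` _ = [set w | decision w = k] `&`
    [set w : sample X K M | outcomes w k == y]); last first.
  apply/seteqP; split=> w /= [wk]; rewrite /outcome wk; first by move=> ->.
  by move=> /eqP.
apply: (@is_cond_prob_fibres _ _ _ _ _ _ _ _ outcomes
  (fun yv => yv k == y)) => yv.
- by apply: measurableI;
    [exact: measurable_decision_eq|exact: measurable_outcomes_eq].
- rewrite setIC; apply: cond_probP; apply: measurableI;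
    [exact: measurable_outcomes_eq|exact: measurable_decision_eq].
Qed.

(** What is used of strong ignorability: g is the common propensity score of all
    vectors of potential outcomes. *)
Lemma ignorable_factor P : ignorable_laws P ->
  exists2 g : level K -> X -> R,
    (forall k, {ae distribution P covariates, forall x, 0 < g k x}) &
    forall k (y : potentials K M), {ae distribution P covariates, forall x,
      cond_prob P ([set w | outcomes w = y] `&` [set w | decision w = k])
        covariates x = g k x * outcomes_cond_law P y x}.
Proof.
move=> [PYX [e [[eX [unc overlap]] PE]]].
have PX A : measurable A -> distribution PYX snd A = distribution P covariates A.
  by move=> mA; rewrite (joint_law_covariates PE).
exists (fun k x => fine (eX x [set k])) => k.
  have := ae_eq_measure PX (overlap k); apply: filterS => x.
  by rewrite -(pker_fineK eX)// lte_fin.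
move=> y.
have := ae_eq_measure PX (unconfounded_factor y (unc k)).
move: (joint_law_cond_outcomes PE y) (joint_law_cond_decision PE y k).
by apply: filterS3 => x -> -> ->.
Qed.

(** Given X, D is independent of Y(k), and it equals k with positive
    probability. *)
Lemma ignorable_observed_cond_law P : ignorable_laws P ->
  {ae distribution P covariates, forall x, forall k y,
    0 < \sum_y' observed_cond_law P k y' x /\
    observed_cond_law P k y x =
      (\sum_(yv : potentials K M | yv k == y) outcomes_cond_law P yv x) *
      \sum_y' observed_cond_law P k y' x}.
Proof.
move=> /ignorable_factor[g g0 gE].
apply: filter_forall => k.
have gk : {ae distribution P covariates, forall x, forall y,
    observed_cond_law P k y x = g k x *
      \sum_(yv : potentials K M | yv k == y) outcomes_cond_law P yv x}.
  apply: filter_forall => y.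
  have : {ae distribution P covariates, forall x, forall yv,
      cond_prob P ([set w | outcomes w = yv] `&` [set w | decision w = k])
        covariates x = g k x * outcomes_cond_law P yv x}.
    by apply: filter_forall => yv; exact: gE.
  apply: filterS2 (observed_cond_law_outcomes P k y) => x -> pE.
  by rewrite mulr_sumr; apply: eq_bigr => yv _; exact: pE.
move: (g0 k) (sum_outcomes_cond_law P) gk; apply: filterS3 => x gk0 p1 gk y.
(* Summing over y, the marginals of Y(k) add up to 1: only g k x is left. *)
have -> : \sum_y' observed_cond_law P k y' x = g k x.
  under eq_bigr do rewrite gk.
  rewrite -mulr_sumr -[RHS]mulr1 -p1; congr (_ * _).
  by rewrite [RHS](partition_big (fun yv : potentials K M => yv k) predT).
by rewrite gk mulrC.
Qed.

(** The two expressions of P(Y = y | D = k, X): as a marginal of the potential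
    outcomes, for the formula of the risk, and as a function of the observed
    law, for identifiability. *)
Lemma ignorable_regression P : ignorable_laws P ->
  {ae distribution P covariates, forall x, forall k y,
    outcome_regression P y k x =
      \sum_(yv : potentials K M | yv k == y) outcomes_cond_law P yv x /\
    outcome_regression P y k x =
      observed_cond_law P k y x / \sum_y' observed_cond_law P k y' x}.
Proof.
move=> /ignorable_observed_cond_law; apply: filterS2 (outcome_regressionP P).
move=> x reg obs k y; have [c0 oE] := obs k y.
have cn0 := lt0r_neq0 c0.
split; last by rewrite reg mulfK.
by apply: (mulIf cn0); rewrite -reg oE.
Qed.

End identification.

(** * Risk of an additive loss *)

Section risk.
Context d (X : measurableType d) (K M : nat) (R : realType).
Variables (P : probability (sample X K M) R) (pi : R.-pker X ~> level K).

(** The k-th term of the loss depends on a vector of potential outcomes through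
    its k-th coordinate only, so the vectors can be grouped by that
    coordinate. *)
Lemma additive_cond_risk (varpi : potentials K M -> X -> R)
    (omega : level K -> level K -> level M -> X -> R) x :
  cond_risk P pi (additive_loss varpi omega) x =
  \sum_(j : level K) \sum_(k : level K) \sum_(y : level M)
    omega k j y x * policy_prob pi j x *
    (\sum_(yv : potentials K M | yv k == y) outcomes_cond_law P yv x)
  + intercept P varpi x.
Proof.
rewrite /cond_risk /additive_loss /intercept.
under eq_bigr do under eq_bigr do rewrite !mulrDl.
under eq_bigr do rewrite big_split/=.
rewrite big_split/= addrC; congr (_ + _).
  apply: eq_bigr => j _.
  under eq_bigr do rewrite -mulrA mulr_suml.
  rewrite exchange_big/=; apply: eq_bigr => k _.
  rewrite (partition_big (fun yv : potentials K M => yv k) predT)//=.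
  apply: eq_bigr => y _; rewrite mulr_sumr; apply: eq_bigr => yv /eqP ->.
  by rewrite mulrA.
rewrite exchange_big/=; apply: eq_bigr => yv _.
by rewrite -mulr_suml -mulr_sumr sum_fine_pker mulr1.
Qed.

End risk.

Theorem theorem1 (R : realType) (d : measure_display) (X : measurableType d)
    (K M : nat) (hK : (2 <= K)%N) (hM : (2 <= M)%N)
    (varpi : potentials K M -> X -> R)
    (omega : level K -> level K -> level M -> X -> R)
    (hvarpi : bounded_measurable
      (fun z : potentials K M * X => varpi z.1 z.2))
    (homega : forall k : level K, bounded_measurable
      (fun z : level K * level M * X => omega k z.1.1 z.1.2 z.2)) :
  (forall (P : probability (sample X K M) R) (pi : R.-pker X ~> level K),
    ignorable_laws P ->
    {ae distribution P covariates, forall x : X,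
      cond_risk P pi (additive_loss varpi omega) x =
      \sum_(j : level K) \sum_(k : level K) \sum_(y : level M)
        omega k j y x * policy_prob pi j x * outcome_regression P y k x
      + intercept P varpi x}) /\
  (forall pi rho : R.-pker X ~> level K,
    identifiable (fun (P : probability (sample X K M) R) (x : X) =>
      cond_risk P pi (additive_loss varpi omega) x -
      cond_risk P rho (additive_loss varpi omega) x)).
Proof.
have riskE (P : probability (sample X K M) R) (pi : R.-pker X ~> level K) :
    ignorable_laws P ->
    {ae distribution P covariates, forall x : X,
      cond_risk P pi (additive_loss varpi omega) x =
      \sum_(j : level K) \sum_(k : level K) \sum_(y : level M)
        omega k j y x * policy_prob pi j x * outcome_regression P y k x
      + intercept P varpi x}.
  move=> /ignorable_regression; apply: filterS => x reg.
  rewrite additive_cond_risk; congr (_ + _).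
  do 3 (apply: eq_bigr => ? _); congr (_ * _).
  exact/esym/(reg _ _).1.
split=> [//|pi rho P1 P2 iP1 iP2 P12 obs].
(* P1 and P2 have the same covariate law, but only on measurable sets. *)
have transfer (Q : X -> Prop) : {ae distribution P2 covariates, forall x, Q x} ->
    {ae distribution P1 covariates, forall x, Q x}.
  by apply: ae_eq_measure => A mA; rewrite P12.
have reg : {ae distribution P1 covariates, forall x, forall k y,
    outcome_regression P1 y k x = outcome_regression P2 y k x}.
  have := transfer _ (ignorable_regression iP2); move: obs.
  apply: filterS3 (ignorable_regression iP1) => x r1 obs r2 k y.
  rewrite (r1 k y).2 (r2 k y).2 obs; congr (_ / _).
  by apply: eq_bigr => y' _; rewrite obs.
have diffE P : ignorable_laws P -> {ae distribution P covariates, forall x : X,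
    cond_risk P pi (additive_loss varpi omega) x -
    cond_risk P rho (additive_loss varpi omega) x =
    \sum_(j : level K) \sum_(k : level K) \sum_(y : level M)
        omega k j y x * policy_prob pi j x * outcome_regression P y k x -
    \sum_(j : level K) \sum_(k : level K) \sum_(y : level M)
        omega k j y x * policy_prob rho j x * outcome_regression P y k x}.
  move=> iP; apply: filterS2 (riskE P pi iP) (riskE P rho iP) => x -> ->.
  by rewrite opprD addrACA subrr addr0.
have := transfer _ (diffE P2 iP2); move: reg (diffE P1 iP1).
apply: filterS3 => x reg -> ->.
by congr (_ - _); do 3 (apply: eq_bigr => ? _); rewrite reg.
Qed.
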